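(* Let $n\geq 1$ be an integer, let $A_1,\ldots,A_n$ be congruence-distributive algebras (of the same signature), and let $A=\prod_{i=1}^nA_i$, where $A$ is congruence-distributive. Then $A$ has FCLP if and only if each of the algebras $A_1,\ldots,A_n$ has FCLP. Likewise, $A$ has CBLP if and only if each of $A_1,\ldots,A_n$ has CBLP.
   Context: Algebras are non-empty universal algebras of a fixed arbitrary signature. For an algebra $A$, $\mathrm{Con}(A)$ is the bounded lattice of congruences of $A$ ordered by inclusion, with meet $\cap$, join $\phi\vee\psi$ = the congruence generated by $\phi\cup\psi$, least element $\Delta_A=\{(a,a)\mid a\in A\}$ and greatest element $\nabla_A=A^2$. $A$ is congruence-distributive if the lattice $\mathrm{Con}(A)$ is distributive; quotients of congruence-distributive algebras are congruence-distributive. For a bounded distributive lattice $L$, $\mathcal{B}(L)$ is the Boolean algebra of complemented elements of $L$. Composition: $\phi\circ\psi=\{(a,b)\in A^2\mid \exists x\in A,\ (a,x)\in\psi,\ (x,b)\in\phi\}$. Let $A$ be congruence-distributive. A congruence $\phi$ of $A$ is a factor congruence if there is $\phi^*\in\mathrm{Con}(A)$ with $\phi\vee\phi^*=\nabla_A$, $\phi\cap\phi^*=\Delta_A$ and $\phi\circ\phi^*=\phi^*\circ\phi$. $\mathrm{FC}(A)$ is the set of factor congruences; it is a Boolean subalgebra of $\mathcal{B}(\mathrm{Con}(A))$. For $\theta\in\mathrm{Con}(A)$ and $\alpha\in\mathrm{Con}(A)$ with $\theta\subseteq\alpha$, $\alpha/\theta=\{(a/\theta,b/\theta)\mid (a,b)\in\alpha\}\in\mathrm{Con}(A/\theta)$.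 The map $u_\theta:\mathrm{Con}(A)\to\mathrm{Con}(A/\theta)$, $u_\theta(\alpha)=(\alpha\vee\theta)/\theta$, is a bounded lattice morphism which maps $\mathrm{FC}(A)$ into $\mathrm{FC}(A/\theta)$ and $\mathcal{B}(\mathrm{Con}(A))$ into $\mathcal{B}(\mathrm{Con}(A/\theta))$. The congruence $\theta$ has FCLP (Factor Congruence Lifting Property) if the restriction $u_\theta|:\mathrm{FC}(A)\to\mathrm{FC}(A/\theta)$ is surjective; $\theta$ has CBLP (Congruence Boolean Lifting Property) if the restriction $u_\theta|:\mathcal{B}(\mathrm{Con}(A))\to\mathcal{B}(\mathrm{Con}(A/\theta))$ is surjective. $A$ has FCLP (respectively CBLP) if every congruence of $A$ has FCLP (respectively CBLP). *)

(* Defs.v *)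
From HB Require Import structures.
From mathcomp Require Import all_boot all_order generic_quotient.
From mathcomp Require Import boolp classical_sets functions.
Set Implicit Arguments.
Unset Strict Implicit.
Unset Printing Implicit Defensive.
Import Order.TTheory.
Local Open Scope quotient_scope.
Local Open Scope order_scope.
Local Open Scope classical_set_scope.

Record signature := Signature {
  symbol : Type;
  arity : symbol -> nat }.

Record algebra (S : signature) := Algebra {
  carrier :> Type;
  carrier_inhabited : inhabited carrier;
  interp : forall f : symbol S, ('I_(arity f) -> carrier) -> carrier }.

Definition prod_algebra (S : signature) (n : nat) (A : 'I_n -> algebra S) :
    algebra S :=
  @Algebra S (forall i, A i)
    (inhabits (fun i => inhabited_witness (carrier_inhabited (A i))))
    (fun f x i => interp (fun k => x k i)).

Definition is_congruence (S : signature) (A : algebra S) (R : set (A * A)) :=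
  [/\ forall a, R (a, a),
      forall a b, R (a, b) -> R (b, a),
      forall a b c, R (a, b) -> R (b, c) -> R (a, c) &
      forall (f : symbol S) (x y : 'I_(arity f) -> A),
        (forall k, R (x k, y k)) -> R (interp x, interp y)].

Record con (S : signature) (A : algebra S) := Con {
  con_set :> set (A * A);
  conP : is_congruence con_set }.

Lemma con_inj (S : signature) (A : algebra S) (phi psi : con A) :
  con_set phi = con_set psi -> phi = psi.
Proof.
case: phi psi => [R HR] [R' HR'] /= eRR'; subst R'.
by congr Con; exact: Prop_irrelevance.
Qed.

Lemma con_diag_subproof (S : signature) (A : algebra S) :
  is_congruence (@diagonal A).
Proof.
split=> //= [a b c|f x y xy]; rewrite /diagonal /=; first by move=> ->.
by congr interp; apply/funext.
Qed.

Definition con_diag (S : signature) (A : algebra S) : con A :=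
  Con (@con_diag_subproof S A).

Definition con_full (S : signature) (A : algebra S) : con A :=
  @Con S A setT (And4 (fun=> I) (fun _ _ => id) (fun _ _ _ _ => id)
                   (fun _ _ _ _ => I)).

Lemma con_meet_subproof (S : signature) (A : algebra S) (phi psi : con A) :
  is_congruence (phi `&` psi).
Proof.
case: phi psi => [P [Pr Ps Pt Pc]] [Q [Qr Qs Qt Qc]] /=.
split=> [a|a b|a b c|f x y h]; first by split.
- by case=> /Ps ? /Qs.
- by case=> pab qab [pbc qbc]; split; [exact: Pt pbc|exact: Qt qbc].
- by split; [apply: Pc|apply: Qc] => k; case: (h k).
Qed.

Definition con_meet (S : signature) (A : algebra S) (phi psi : con A) : con A :=
  Con (con_meet_subproof phi psi).

Lemma con_gen_subproof (S : signature) (A : algebra S) (R : set (A * A)) :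
  is_congruence [set ab | forall chi : con A, R `<=` chi -> con_set chi ab].
Proof.
split=> [a chi|a b h chi Rchi|a b c h h' chi Rchi|f x y h chi Rchi] /=;
  have [cr cs ct cc] := conP chi.
- by move=> _; exact: cr.
- exact: cs (h _ Rchi).
- exact: ct (h _ Rchi) (h' _ Rchi).
- by apply: cc => k; exact: h.
Qed.

Definition con_gen (S : signature) (A : algebra S) (R : set (A * A)) : con A :=
  Con (con_gen_subproof R).

Definition con_join (S : signature) (A : algebra S) (phi psi : con A) : con A :=
  con_gen (phi `|` psi).

Definition con_le (S : signature) (A : algebra S) (phi psi : con A) : bool :=
  `[< phi `<=` psi >].

Lemma con_le_refl (S : signature) (A : algebra S) : reflexive (@con_le S A).
Proof. by move=> phi; apply/asboolP. Qed.

Lemma con_le_anti (S : signature) (A : algebra S) : antisymmetric (@con_le S A).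
Proof.
move=> phi psi /andP[/asboolP h /asboolP h'].
by apply: con_inj; apply/seteqP.
Qed.

Lemma con_le_trans (S : signature) (A : algebra S) : transitive (@con_le S A).
Proof.
by move=> psi phi chi /asboolP h /asboolP h'; apply/asboolP; exact: subset_trans h'.
Qed.

HB.instance Definition _ (S : signature) (A : algebra S) := gen_eqMixin (con A).
HB.instance Definition _ (S : signature) (A : algebra S) :=
  gen_choiceMixin (con A).

Fact con_display : Order.disp_t. Proof. exact: Order.Disp tt tt. Qed.

HB.instance Definition _ (S : signature) (A : algebra S) :=
  Order.Le_isPOrder.Build con_display (con A)
    (@con_le_refl S A) (@con_le_anti S A) (@con_le_trans S A).

Lemma con_leP (S : signature) (A : algebra S) (phi psi : con A) :
  reflect (phi `<=` psi) (phi <= psi)%O.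
Proof. exact: asboolP. Qed.

Lemma con_lexI (S : signature) (A : algebra S) (phi psi chi : con A) :
  (phi <= con_meet psi chi)%O = (phi <= psi)%O && (phi <= chi)%O.
Proof.
apply/con_leP/andP => [|[/con_leP h /con_leP h']]; rewrite /con_meet /= subsetI //.
by case=> h h'; split; apply/con_leP.
Qed.

Lemma con_leUx (S : signature) (A : algebra S) (phi psi chi : con A) :
  (con_join phi psi <= chi)%O = (phi <= chi)%O && (psi <= chi)%O.
Proof.
apply/con_leP/andP => [h|[/con_leP h /con_leP h'] ab]; last first.
  by apply; rewrite subUset.
by split; apply/con_leP => ab hab; apply: h => xi; apply; [left|right].
Qed.

Lemma con_le0x (S : signature) (A : algebra S) (phi : con A) :
  (con_diag A <= phi)%O.
Proof.
have [r _ _ _] := conP phi.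
by apply/con_leP => -[a b]; rewrite /= /diagonal /= => ->; exact: r.
Qed.

Lemma con_lex1 (S : signature) (A : algebra S) (phi : con A) :
  (phi <= con_full A)%O.
Proof. by apply/con_leP. Qed.

HB.instance Definition _ (S : signature) (A : algebra S) :=
  Order.POrder_isMeetSemilattice.Build con_display (con A) (@con_lexI S A).
HB.instance Definition _ (S : signature) (A : algebra S) :=
  Order.POrder_isJoinSemilattice.Build con_display (con A) (@con_leUx S A).
HB.instance Definition _ (S : signature) (A : algebra S) :=
  Order.hasBottom.Build con_display (con A) (@con_le0x S A).
HB.instance Definition _ (S : signature) (A : algebra S) :=
  Order.hasTop.Build con_display (con A) (@con_lex1 S A).

Definition congruence_distributive (S : signature) (A : algebra S) :=
  left_distributive (@Order.meet _ (con A)) (@Order.join _ (con A)).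

Definition con_rel (S : signature) (A : algebra S) (theta : con A) :
    rel {classic A} :=
  fun a b => `[< con_set theta (a, b) >].

Lemma con_rel_equiv (S : signature) (A : algebra S) (theta : con A) :
  equiv_class_of (con_rel theta).
Proof.
have [tr ts tt _] := conP theta; split=> [a|a b|b a c].
- exact/asboolP.
- by apply/asboolP/asboolP; exact: ts.
- by move=> /asboolP h /asboolP h'; apply/asboolP; exact: tt h'.
Qed.

Canonical con_equiv_rel (S : signature) (A : algebra S) (theta : con A) :=
  EquivRelPack (con_rel_equiv theta).

Definition quot_carrier (S : signature) (A : algebra S) (theta : con A) :=
  {eq_quot con_equiv_rel theta}.

Definition quot_class (S : signature) (A : algebra S) (theta : con A) (a : A) :
    quot_carrier theta :=
  \pi_(quot_carrier theta)%qT (a : {classic A}).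

(* Operations act on chosen representatives; [interp_quot_class] shows that the
   choice is irrelevant. *)
Definition quot_algebra (S : signature) (A : algebra S) (theta : con A) :
    algebra S :=
  @Algebra S (quot_carrier theta)
    (let: inhabits a := carrier_inhabited A in inhabits (quot_class theta a))
    (fun f x => quot_class theta (interp (fun k => repr (x k) : A))).

Lemma quot_classP (S : signature) (A : algebra S) (theta : con A) (a b : A) :
  quot_class theta a = quot_class theta b <-> con_set theta (a, b).
Proof.
split=> [/eqP|h]; first by rewrite eqmodE => /asboolP.
by apply/eqP; rewrite eqmodE; apply/asboolP.
Qed.

Lemma quot_class_repr (S : signature) (A : algebra S) (theta : con A)
    (x : quot_algebra theta) :
  quot_class theta (repr (x : quot_carrier theta)) = x.
Proof. exact: reprK. Qed.

Lemma interp_quot_class (S : signature) (A : algebra S) (theta : con A)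
    (f : symbol S) (x : 'I_(arity f) -> A) :
  @interp S (quot_algebra theta) f (fun k => quot_class theta (x k)) =
  quot_class theta (interp x).
Proof.
have [_ _ _ tc] := conP theta.
apply/quot_classP; apply: tc => k.
by apply/quot_classP; rewrite quot_class_repr.
Qed.

Definition quot_rel (S : signature) (A : algebra S) (theta alpha : con A) :
    set (quot_algebra theta * quot_algebra theta) :=
  [set (quot_class theta ab.1, quot_class theta ab.2) | ab in con_set alpha].
Arguments quot_rel {S A} theta alpha.

Lemma con_quot_subproof (S : signature) (A : algebra S) (theta alpha : con A) :
  (theta <= alpha)%O -> is_congruence (quot_rel theta alpha).
Proof.
move=> /con_leP ta; have [ar as_ at_ ac] := conP alpha.
have relP a b : quot_rel theta alpha (quot_class theta a, quot_class theta b) ->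
    con_set alpha (a, b).
  case=> -[a' b'] /= h [/quot_classP/ta ha /quot_classP/ta hb].
  exact: at_ (as_ _ _ ha) (at_ _ _ _ h hb).
split.
- by move=> a; exists (repr a, repr a); [exact: ar|rewrite /= quot_class_repr].
- by move=> _ _ [[a b] h [<- <-]]; exists (b, a) => //; exact: as_.
- move=> a b c; rewrite -(quot_class_repr a) -(quot_class_repr b).
  rewrite -(quot_class_repr c) => /relP h /relP h'.
  by exists (repr a, repr c) => //; exact: at_ h h'.
- move=> f x y h.
  exists (interp (fun k => repr (x k) : A), interp (fun k => repr (y k) : A)) => //.
  apply: ac => k; apply: relP; rewrite !quot_class_repr; exact: h.
Qed.

Definition con_quot (S : signature) (A : algebra S) (theta alpha : con A)
    (le_theta_alpha : (theta <= alpha)%O) : con (quot_algebra theta) :=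
  Con (con_quot_subproof le_theta_alpha).

Definition quot_map (S : signature) (A : algebra S) (theta : con A)
    (alpha : con A) : con (quot_algebra theta) :=
  con_quot (leUr theta alpha : theta <= alpha `|` theta)%O.
Arguments quot_map {S A} theta alpha.

Definition complemented (d : Order.disp_t) (L : tbLatticeType d) : set L :=
  [set x | exists y, (x `|` y = \top)%O /\ (x `&` y = \bot)%O].

Definition factor_con (S : signature) (A : algebra S) : set (con A) :=
  [set phi | exists phi' : con A,
    [/\ (phi `|` phi' = \top)%O, (phi `&` phi' = \bot)%O &
        (con_set phi \; con_set phi')%relation =
        (con_set phi' \; con_set phi)%relation]].

Definition con_FCLP (S : signature) (A : algebra S) (theta : con A) :=
  set_surj (@factor_con S A) (@factor_con S (quot_algebra theta))
    (quot_map theta).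

Definition con_CBLP (S : signature) (A : algebra S) (theta : con A) :=
  set_surj (@complemented _ (con A)) (@complemented _ (con (quot_algebra theta)))
    (quot_map theta).

Definition has_FCLP (S : signature) (A : algebra S) :=
  forall theta : con A, con_FCLP theta.

Definition has_CBLP (S : signature) (A : algebra S) :=
  forall theta : con A, con_CBLP theta.

(* Main.v *)
Require Import Defs.
From mathcomp Require Import all_boot order generic_quotient.
From mathcomp Require Import boolp classical_sets functions.
Import Order.TTheory.

Set Implicit Arguments.
Unset Strict Implicit.
Unset Printing Implicit Defensive.

(** Call [A] lifting if every pair [alpha], [beta] with [alpha \/ beta = top]
    (for CBLP) or [alpha o beta = top] (for FCLP) arises from a complementary
    pair [gamma], [delta] of the same kind with
    [gamma \/ (alpha /\ beta) = alpha]; by the correspondence theorem, with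
    [theta = alpha /\ beta], this is CBLP or FCLP.

    By distributivity a complementary pair of [Con A] remains complementary
    modulo a congruence, so lifting passes to homomorphic images, in particular
    to the factors of a product. Conversely, let [ker i] be the kernels of the
    projections of a finite product. Distributivity gives
    [theta = /\_i (theta \/ ker i)], so congruences may be compared modulo each
    [ker i], that is, coordinatewise, and coordinatewise solutions [gamma i]
    combine into a solution for the product. *)

(** * Covering pairs of congruences and the lifting property *)

Section Lifting.
Local Open Scope classical_set_scope.
Context {S : signature}.
Implicit Types A B : algebra S.

(** The flag treats FCLP ([true]) and CBLP ([false]) at once. The composite takes its [psi] step
    first. *)
Definition covering A (permuting : bool) (phi psi : con A) : Prop :=
  if permuting then (con_set phi \; con_set psi)%relation = setT
  else (phi `|` psi = \top)%O.

Definition lifting (permuting : bool) A : Prop :=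
  forall alpha beta : con A, covering permuting alpha beta ->
  exists gamma delta : con A,
    [/\ covering permuting gamma delta, (gamma `&` delta = \bot)%O &
        (gamma `|` (alpha `&` beta) = alpha)%O].

Lemma covering_mono A p (phi psi phi' psi' : con A) :
  (phi <= phi')%O -> (psi <= psi')%O -> covering p phi psi ->
  covering p phi' psi'.
Proof.
move=> hphi hpsi; case: p => /= h; last first.
  by apply/le_anti; rewrite lex1 -h leU2.
move/con_leP: hphi => hphi; move/con_leP: hpsi => hpsi.
rewrite -subTset => -[a b] _.
have : (con_set phi \; con_set psi)%relation (a, b) by rewrite h.
by move=> [c /= /hpsi ac /hphi cb]; exists c.
Qed.

(** A full composite lies inside the join, and symmetry of both congruences makes the reversed
    composite full too. Conversely, permutability makes the composite a congruence containing [phi]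
    and [psi], hence their join. *)
Lemma permuting_joinP A (phi psi : con A) :
  (phi `|` psi = \top)%O /\ (con_set phi \; con_set psi)%relation =
    (con_set psi \; con_set phi)%relation <->
  covering true phi psi.
Proof.
have [fr fs ft fc] := conP phi; have [gr gs gt gc] := conP psi.
have swap a b : (con_set phi \; con_set psi)%relation (a, b) ->
    (con_set psi \; con_set phi)%relation (b, a).
  by move=> [c ac cb]; exists c; [exact: fs|exact: gs].
split=> [[hT hC]|hT]; last first.
  split.
    apply/le_anti; rewrite lex1; apply/con_leP => -[a b] _.
    have [c ac cb] : (con_set phi \; con_set psi)%relation (a, b) by rewrite hT.
    have [_ _ t _] := conP (phi `|` psi)%O.
    apply: (t a c b); first by apply: (con_leP _ _ (leUr _ _)); exact: ac.
    by apply: (con_leP _ _ (leUl _ _)); exact: cb.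
  rewrite hT; apply/esym; rewrite -subTset => -[a b] _.
  by apply: swap; rewrite hT.
have hR : is_congruence (con_set phi \; con_set psi)%relation.
  split=> [a|a b /swap|a b c|f x y h].
  - by exists a.
  - by rewrite hC.
  - move=> [d ad db]; rewrite {1}hC => -[e be ec].
    have : (con_set phi \; con_set psi)%relation (a, e).
      by exists d => //; exact: ft db be.
    by rewrite hC => -[k ak ke]; exists k => //; exact: gt ke ec.
  - have {h}[z hz] := choice (fun k => let: ex_intro2 c p q := h k in
      ex_intro (fun c => con_set psi (x k, c) /\ con_set phi (c, y k)) c (conj p q)).
    by exists (interp z); [apply: gc => k|apply: fc => k]; have [] := hz k.
have : (phi `|` psi <= Con hR)%O.
  rewrite leUx; apply/andP; split; apply/con_leP => -[a b] ab.
    by exists a => //; exact: gr.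
  by exists b => //; exact: fr.
rewrite hT /= => /con_leP h; rewrite -subTset; exact: h.
Qed.

Lemma factor_conP A (phi : con A) :
  factor_con phi <->
  exists psi, covering true phi psi /\ (phi `&` psi = \bot)%O.
Proof.
split=> [[psi [h1 h2 h3]]|[psi [/permuting_joinP[h1 h2] h3]]]; exists psi => //.
by split=> //; apply/permuting_joinP.
Qed.

Lemma join_meet_distr A : congruence_distributive A ->
  right_distributive (@Order.join _ (con A)) (@Order.meet _ (con A)).
Proof.
move=> hd x y z.
by rewrite hd joinKI [(y `&` (_ `|` _))%O]meetC hd joinA meetKU (meetC z).
Qed.

(** * Congruences along a surjective homomorphism *)

Section Homomorphism.
Context {A B : algebra S} (h : A -> B).
Hypothesis h_interp : forall f (x : 'I_(arity f) -> A),
  h (interp x) = interp (h \o x).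

Lemma con_preim_subproof (phi : con B) :
  is_congruence [set ab | con_set phi (h ab.1, h ab.2)].
Proof.
have [r s t c] := conP phi; split=> [a|a b|a b d|f x y xy] /=.
- exact: r.
- exact: s.
- exact: t.
- by rewrite !h_interp; apply: c.
Qed.

Definition con_preim (phi : con B) : con A := Con (con_preim_subproof phi).

Lemma con_preimI (phi psi : con B) :
  con_preim (phi `&` psi)%O = (con_preim phi `&` con_preim psi)%O.
Proof. exact: con_inj. Qed.

Lemma con_preimT : con_preim \top%O = \top%O.
Proof. exact: con_inj. Qed.

Hypothesis h_surj : forall b, exists a, h a = b.

Lemma le_con_preim (phi psi : con B) :
  (con_preim phi <= con_preim psi)%O = (phi <= psi)%O.
Proof.
apply/con_leP/con_leP => [hle [b b']|hle [a a']]; last exact: hle.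
by have [[a <-] [a' <-]] := (h_surj b, h_surj b'); exact: (hle (a, a')).
Qed.

Lemma con_preim_inj : injective con_preim.
Proof. by move=> phi psi e; apply/le_anti; rewrite -!le_con_preim e lexx. Qed.

(** Correspondence theorem: the witness is the direct image [R] of [alpha]. *)
Lemma con_preim_onto (alpha : con A) :
  (con_preim \bot <= alpha)%O -> exists phi, alpha = con_preim phi.
Proof.
move=> /con_leP hle; have [r s t c] := conP alpha.
have ker a b : h a = h b -> con_set alpha (a, b) by move=> e; exact: hle.
pose R := [set (h ab.1, h ab.2) | ab in con_set alpha].
(* As [alpha] contains the kernel of [h], relatedness under [R] does not depend on the chosen
   preimages. *)
have RP a b : R (h a, h b) -> con_set alpha (a, b).
  case=> -[a' b'] /= ab [/esym/ker ha /ker hb].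
  exact: t ha (t _ _ _ ab hb).
have hR : is_congruence R.
  split=> [b|a b|a b d|f x y xy].
  - by have [a <-] := h_surj b; exists (a, a).
  - by case=> -[a' b'] /= ab [<- <-]; exists (b', a') => //; exact: s.
  - have [[a' <-] [[b' <-] [d' <-]]] := (h_surj a, (h_surj b, h_surj d)).
    by move=> /RP ab /RP bd; exists (a', d') => //; exact: t ab bd.
  - have [[x' hx] [y' hy]] :=
      (choice (fun k => h_surj (x k)), choice (fun k => h_surj (y k))).
    have -> : x = h \o x' by apply/funext => k; rewrite /= hx.
    have -> : y = h \o y' by apply/funext => k; rewrite /= hy.
    exists (interp x', interp y'); last by rewrite /= !h_interp.
    by apply: c => k; apply: RP; rewrite hx hy.
exists (Con hR); apply/con_inj/seteqP; split=> -[a b]; last exact: RP.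
by move=> ab; exists (a, b).
Qed.

(** Both pullbacks contain the kernel, so their join is itself a pullback [con_preim chi]; as
    [con_preim] preserves and reflects order, [chi] is the join of [phi] and [psi]. *)
Lemma con_preimU (phi psi : con B) :
  con_preim (phi `|` psi)%O = (con_preim phi `|` con_preim psi)%O.
Proof.
have [chi e] : exists chi, (con_preim phi `|` con_preim psi)%O = con_preim chi.
  by apply: con_preim_onto; rewrite (le_trans _ (leUl _ _))// le_con_preim.
apply/le_anti; rewrite leUx !le_con_preim leUl leUr andbT e le_con_preim leUx.
by rewrite -!le_con_preim -e leUl leUr.
Qed.

Lemma covering_preim p (phi psi : con B) :
  covering p (con_preim phi) (con_preim psi) <-> covering p phi psi.
Proof.
case: p => /=; last first.
  rewrite -con_preimU; split=> [|->]; last exact: con_preimT.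
  by rewrite -con_preimT => /con_preim_inj.
split=> e; rewrite -subTset => -[a b] _.
  have [[a' <-] [b' <-]] := (h_surj a, h_surj b).
  have [c ac cb] : (con_set (con_preim phi) \; con_set (con_preim psi))%relation
    (a', b') by rewrite e.
  by exists (h c).
have : (con_set phi \; con_set psi)%relation (h a, h b) by rewrite e.
by move=> [d]; have [c <-] := h_surj d; exists c.
Qed.

Lemma lifting_image p : congruence_distributive A -> lifting p A -> lifting p B.
Proof.
move=> hd lA alpha beta /covering_preim /lA[gamma [delta [cov disj join]]].
(* The pair found in [A] is enlarged by the kernel of [h] so that it descends to [B]. *)
have [gamma' eg] : exists phi, (gamma `|` con_preim \bot)%O = con_preim phi.
  by apply: con_preim_onto; exact: leUr.
have [delta' ed] : exists phi, (delta `|` con_preim \bot)%O = con_preim phi.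
  by apply: con_preim_onto; exact: leUr.
exists gamma', delta'; split.
- apply/covering_preim; rewrite -eg -ed.
  by apply: covering_mono cov; exact: leUl.
- apply: con_preim_inj; rewrite con_preimI -eg -ed.
  (* By distributivity the enlarged pair meets in the join of [gamma /\ delta] with the kernel,
     which is the kernel. *)
  by rewrite -![(_ `|` con_preim _)%O]joinC -join_meet_distr// disj joinx0.
- apply: con_preim_inj; rewrite con_preimU con_preimI -eg joinAC join.
  by apply/join_idPl; rewrite le_con_preim le0x.
Qed.

End Homomorphism.

(** * Lifting as surjectivity onto complementary pairs of quotients *)

Section Quotient.
Context {A : algebra S}.

Lemma quot_class_interp (theta : con A) f (x : 'I_(arity f) -> A) :
  quot_class theta (interp x) =
  interp (quot_class theta \o x : _ -> quot_algebra theta) :> quot_algebra theta.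
Proof. by rewrite -interp_quot_class. Qed.

Local Notation preim theta := (con_preim (quot_class_interp theta)).

Lemma quot_class_surj (theta : con A) (b : quot_algebra theta) :
  exists a, quot_class theta a = b.
Proof. by exists (repr b); exact: quot_class_repr. Qed.

Lemma preim_quot_bot (theta : con A) : preim theta \bot%O = theta.
Proof.
by apply/con_inj/seteqP; split=> -[a b] /quot_classP.
Qed.

(** Under the correspondence [quot_map theta] is join with [theta]; this turns surjectivity into the
    last equation of [lifting]. *)
Lemma preim_quot_map (theta gamma : con A) :
  preim theta (quot_map theta gamma) = (gamma `|` theta)%O.
Proof.
have [r s t _] := conP (gamma `|` theta)%O.
apply/con_inj/seteqP; split=> -[a b] /=; last by exists (a, b).
have sub c d : con_set theta (c, d) -> con_set (gamma `|` theta)%O (c, d).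
  by apply: (con_leP _ _ (leUr _ _)).
case=> -[a' b'] /= ab [/quot_classP/sub/s ha /quot_classP/sub hb].
exact: t ha (t _ _ _ ab hb).
Qed.

(** A complementary pair of the quotient pulls back to a covering pair with meet [theta];
    conversely, a covering pair becomes complementary modulo its own meet. *)
Lemma liftingP p :
  lifting p A <->
  forall theta : con A, set_surj
    [set phi : con A |
      exists psi, covering p phi psi /\ (phi `&` psi = \bot)%O]
    [set phi : con (quot_algebra theta) |
      exists psi, covering p phi psi /\ (phi `&` psi = \bot)%O]
    (quot_map theta).
Proof.
split=> [lA theta phi [psi [cov disj]]|surj alpha beta cov].
  have qs := @quot_class_surj theta.
  have e : (preim theta phi `&` preim theta psi = theta)%O.
    by rewrite -con_preimI disj preim_quot_bot.
  have [|gamma [delta [cov' disj' join]]] := lA (preim theta phi) (preim theta psi).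
    exact/covering_preim.
  exists gamma; first by exists delta.
  apply: (con_preim_inj (h_interp := quot_class_interp theta) qs).
  by rewrite preim_quot_map -join e.
set theta := (alpha `&` beta)%O.
have qs := @quot_class_surj theta.
have [phi ephi] : exists phi, alpha = preim theta phi.
  by apply: con_preim_onto => //; rewrite preim_quot_bot leIl.
have [psi epsi] : exists psi, beta = preim theta psi.
  by apply: con_preim_onto => //; rewrite preim_quot_bot leIr.
have [|gamma [delta [cov' disj]] e] := surj theta phi.
  exists psi; split.
    by apply/(covering_preim (quot_class_interp theta) qs); rewrite -ephi -epsi.
  apply: (con_preim_inj (h_interp := quot_class_interp theta) qs).
  by rewrite con_preimI -ephi -epsi preim_quot_bot.
by exists gamma, delta; split=> //; rewrite -preim_quot_map e -ephi.
Qed.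

Lemma has_FCLP_lifting : has_FCLP A <-> lifting true A.
Proof.
have E (B : algebra S) : @factor_con S B = [set phi |
    exists psi, covering true phi psi /\ (phi `&` psi = \bot)%O].
  by apply/seteqP; split=> phi /factor_conP.
by rewrite liftingP /has_FCLP /con_FCLP; under eq_forall do rewrite !E.
Qed.

(** With the flag [false], the sets in [liftingP] unfold to [complemented]. *)
Lemma has_CBLP_lifting : has_CBLP A <-> lifting false A.
Proof. by rewrite liftingP. Qed.

End Quotient.

(** * Finite products, coordinate by coordinate *)

Section Product.
Context {n : nat} {A : 'I_n -> algebra S}.
Local Notation P := (prod_algebra A).

Lemma proj_interp i f (x : 'I_(arity f) -> P) :
  (interp x : P) i = interp ((fun a : P => a i) \o x).
Proof. by []. Qed.

Local Notation preim i := (con_preim (@proj_interp i)).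
Local Notation ker i := (preim i \bot%O).

Lemma proj_surj i (b : A i) : exists a : P, a i = b.
Proof.
exists (dfwith (fun j => inhabited_witness (carrier_inhabited (A j))) b).
exact: dfwith_in.
Qed.

Lemma con_prod_subproof (phi : forall i, con (A i)) :
  is_congruence [set ab : P * P | forall i, con_set (phi i) (ab.1 i, ab.2 i)].
Proof.
split=> [a i|a b ab i|a b c ab bc i|f x y xy i]; have [r s t c'] := conP (phi i).
- exact: r.
- exact/s/ab.
- exact: t (ab i) (bc i).
- by apply: c' => k; exact: xy.
Qed.

Definition con_prod (phi : forall i, con (A i)) : con P :=
  Con (con_prod_subproof phi).

Lemma con_prod_join_ker (phi : forall i, con (A i)) i :
  (con_prod phi `|` ker i)%O = preim i (phi i).
Proof.
apply/le_anti/andP; split.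
  rewrite leUx le_con_preim ?le0x ?andbT; last exact: proj_surj.
  by apply/con_leP => -[a b]; apply.
apply/con_leP => -[a b] /= ab.
have [_ _ t _] := conP (con_prod phi `|` ker i)%O.
(* The middle point is [a] with coordinate [i] replaced by that of [b]: [con_prod phi] links it to
   [a], and [ker i] links it to [b]. *)
apply: (t a (dfwith a (b i)) b).
  apply: (con_leP _ _ (leUl _ _)) => j /=.
  by case: dfwithP => // k _; have [] := conP (phi k).
by apply: (con_leP _ _ (leUr _ _)) => /=; exact: dfwith_in.
Qed.

Hypothesis hd : congruence_distributive P.

(** The dual distributive law takes [theta] out of the finite meet, and the kernels meet in the
    diagonal. *)
Lemma con_meet_join_ker (theta : con P) :
  (\meet_i (theta `|` ker i) = theta)%O.
Proof.
rewrite -(big_morph (fun x => theta `|` x)%O (join_meet_distr hd theta) (joinx1 _)).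
rewrite [X in (_ `|` X)%O](_ : _ = \bot)%O ?joinx0//.
apply/le_anti; rewrite le0x andbT; apply/con_leP => -[a b] ab.
apply: functional_extensionality_dep => i.
have : (\meet_i ker i <= ker i)%O by exact: meets_inf.
by move=> /con_leP /(_ (a, b) ab).
Qed.

Lemma eq_mod_ker (phi psi : con P) :
  (forall i, (phi `|` ker i = psi `|` ker i)%O) -> phi = psi.
Proof.
by move=> e; rewrite -(con_meet_join_ker phi) -(con_meet_join_ker psi);
  apply: eq_bigr.
Qed.

Lemma covering_con_prod p (phi psi : forall i, con (A i)) :
  (forall i, covering p (phi i) (psi i)) ->
  covering p (con_prod phi) (con_prod psi).
Proof.
case: p => /= cov.
  rewrite -subTset => -[a b] _.
  have h i : exists c, con_set (psi i) (a i, c) /\ con_set (phi i) (c, b i).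
    have [c ac cb] : (con_set (phi i) \; con_set (psi i))%relation (a i, b i).
      by rewrite cov.
    by exists c.
  exists (fun i => projT1 (cid (h i))) => i /=; by case: cid => ? [].
apply: eq_mod_ker => i; rewrite join1x.
(* The kernel is doubled so that each product congruence absorbs one copy. *)
rewrite -[ker i]joinxx joinACA !con_prod_join_ker -con_preimU ?cov//.
  exact: con_preimT.
exact: proj_surj.
Qed.

Lemma con_prod_disjoint (phi psi : forall i, con (A i)) :
  (forall i, (phi i `&` psi i = \bot)%O) ->
  (con_prod phi `&` con_prod psi = \bot)%O.
Proof.
move=> disj; apply/le_anti; rewrite le0x andbT; apply/con_leP => -[a b] [ha hb].
apply: functional_extensionality_dep => i.
have : con_set (phi i `&` psi i)%O (a i, b i) by split; [exact: ha|exact: hb].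
by rewrite disj.
Qed.

Lemma lifting_prod p : lifting p P <-> forall i, lifting p (A i).
Proof.
split=> [lP i|lA alpha beta cov].
  exact: lifting_image (@proj_interp i) (@proj_surj i) _ hd lP.
have factor (theta : con P) i : exists phi, (theta `|` ker i)%O = preim i phi.
  by apply: con_preim_onto; [exact: proj_surj|exact: leUr].
have sol i : exists gd : con (A i) * con (A i),
    [/\ covering p gd.1 gd.2, (gd.1 `&` gd.2 = \bot)%O &
     (preim i gd.1 `|` (alpha `&` beta) `|` ker i = alpha `|` ker i)%O].
  have [[phi ephi] [psi epsi]] := (factor alpha i, factor beta i).
  have [|gamma [delta [cov' disj join]]] := lA i phi psi.
    apply/(covering_preim (@proj_interp i) (@proj_surj i)).
    by rewrite -ephi -epsi; apply: covering_mono cov; exact: leUl.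
  exists (gamma, delta); split=> //=.
  (* Joining with [ker i] distributes over [alpha /\ beta], so the equation becomes the pullback of
     the one solved in [A i]. *)
  rewrite -joinA [((alpha `&` beta) `|` _)%O]joinC join_meet_distr//.
  rewrite !(joinC (ker i)) ephi epsi -con_preimI -con_preimU ?join//.
  exact: proj_surj.
pose g i := projT1 (cid (sol i)).
have gP i := projT2 (cid (sol i)).
exists (con_prod (fun i => (g i).1)), (con_prod (fun i => (g i).2)); split.
- by apply: covering_con_prod => i; have [] := gP i.
- by apply: con_prod_disjoint => i; have [] := gP i.
- apply: eq_mod_ker => i; have [_ _ <-] := gP i.
  (* Modulo [ker i] the product congruence agrees with the pullback of its component, and the
     repeated kernel collapses. *)
  rewrite -(con_prod_join_ker (fun i => (g i).1)).
  by rewrite [RHS]joinAC -(joinA _ (ker i) (ker i)) joinxx [RHS]joinAC.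
Qed.

End Product.
End Lifting.

Theorem proposition3p10 (S : signature) (n : nat) (hn : 1 <= n)
    (A : 'I_n -> algebra S)
    (hA : forall i, congruence_distributive (A i))
    (hprod : congruence_distributive (prod_algebra A)) :
  (has_FCLP (prod_algebra A) <-> forall i, has_FCLP (A i)) /\
  (has_CBLP (prod_algebra A) <-> forall i, has_CBLP (A i)).
Proof.
split.
  rewrite has_FCLP_lifting (lifting_prod hprod).
  by split=> h i; apply/has_FCLP_lifting.
rewrite has_CBLP_lifting (lifting_prod hprod).
by split=> h i; apply/has_CBLP_lifting.
Qed.
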